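(* For each integer $m\ge 0$ let $T_m(x)=\cos(m\cos^{-1}(x))$, $-1<x<1$, be the Chebyshev polynomial, and let $$\hat T_m(\lambda)=\int_{-1}^1 e^{-i\lambda x}T_m(x)\,dx,\qquad \lambda\in\mathbb C,$$ be its finite Fourier transform. Then $$\hat T_m(0)=\begin{cases}0,& m=1,\\[2pt] \dfrac{(-1)^{m+1}-1}{m^2-1},& m=0,2,3,\ldots.\end{cases}$$ Furthermore, for all $\lambda\in\mathbb C\setminus\{0\}$ and all $m=0,1,2,\ldots$, $$\hat T_m(\lambda)=\sum_{n=1}^{m+1}\alpha_n^m\left[\frac{e^{i\lambda}}{(i\lambda)^n}+(-1)^{n+m}\frac{e^{-i\lambda}}{(i\lambda)^n}\right],$$ where the coefficients $\alpha_n^m$ are defined by $$\alpha_1^m=(-1)^m,\qquad \alpha_2^m=(-1)^{m+1}m^2,$$ $$\alpha_n^m=(-1)^{m+n-1}2^{n-2}\,m\sum_{k=1}^{m-n+2}\binom{n+k-3}{k-1}\prod_{j=k}^{n+k-3}(m-j),\qquad n=3,4,\ldots,m+1.$$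
   Context: Here $\binom{a}{b}$ denotes the usual binomial coefficient and $i$ the imaginary unit. *)

(* Defs.v *)
(* Stdlib's classical reals R, with Coquelicot's complex numbers C and
   Riemann integral. *)
From Stdlib Require Import Reals.
From Coquelicot Require Import Coquelicot.

Open Scope R_scope.

Definition Cexp (z : C) : C :=
  (exp (Re z) * cos (Im z), exp (Re z) * sin (Im z)).

Definition chebT (m : nat) (x : R) : R := cos (INR m * acos x).

(* C is taken as a complete normed module over R, so that RInt integrates a
   C-valued function of a real variable. *)
Definition chebT_hat (m : nat) (lambda : C) : C :=
  RInt (V := C_R_CompleteNormedModule)
    (fun x : R => (Cexp (- (Ci * lambda * RtoC x)) * RtoC (chebT m x))%C)
    (-1) 1.

(* Meaningful for 1 <= n <= m + 1; the value at n = 0 is a dummy.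
   prod_f_R0 f N multiplies f 0, ..., f N, so with j = k + l the product ranges
   over j = k, ..., n + k - 3.  Binomial.C is Stdlib's real-valued binomial
   coefficient.  No natural-number subtraction truncates on the meaningful range,
   where also m - j >= 1. *)
Definition alpha (m n : nat) : R :=
  match n with
  | 0%nat => 0
  | 1%nat => (-1) ^ m
  | 2%nat => (-1) ^ (m + 1) * INR m ^ 2
  | _ =>
      (-1) ^ (m + n - 1) * 2 ^ (n - 2) * INR m *
      sum_n_m
        (fun k : nat =>
           Binomial.C (n + k - 3) (k - 1) *
           prod_f_R0 (fun l : nat => INR m - INR (k + l)) (n - 3))
        1 (m + 2 - n)
  end.

(* Main.v *)
Require Import Defs.
From Stdlib Require Import Reals Factorial Lra Lia.
From Coquelicot Require Import Coquelicot.

Open Scope R_scope.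

(** For lambda <> 0 the expansion is repeated integration by parts: with
    mu = i lambda, the function

      - sum_(1 <= n <= m+1) exp (- mu x) T_m^(n-1)(x) / mu^n

    has a telescoping derivative, namely exp (- mu x) T_m(x), because the
    derivative T_m^(m+1) vanishes ([is_derive_by_parts], [chebD_above_degree]).
    Its boundary values involve T_m^(p)(1) and T_m^(p)(-1), which differ by the
    sign (-1)^(m+p) ([chebD_opp]).  Everything thus reduces to

      alpha_(p+1)^m = (-1)^(m+p) T_m^(p)(1)      ([alpha_chebD]).

    The derivatives at 1 are found from the Chebyshev recurrence
    T_(m+2) = 2 x T_(m+1) - T_m.  Differentiated p times and evaluated at 1, it
    says that the second difference in m of T_m^(p)(1) is
    2 p T_(m+1)^(p-1)(1).  Two uses of Pascal's rule show that

      2^(p-1) p! (binom (m+p) (2p) + binom (m+p-1) (2p))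

    satisfies the same recurrence with the same initial values
    ([chebD_at_1]), and for p >= 1 it equals
    2^(p-1) (p-1)! m binom (m+p-1) (2p-1).  The sum defining alpha has this
    value because its product is (n-2)! times a binomial coefficient, which
    turns the sum into the convolution

      sum_i binom (r+i) r * binom (s+M-i) s = binom (r+s+1+M) (r+s+1)

    ([gbin_convolution]).

    For lambda = 0 and m <> 1, a primitive of T_m is
    (m T_(m+1) - (m+1) x T_m) / (m^2 - 1), which follows from T_m' = m U_(m-1)
    and U_m = x U_(m-1) + T_m ([chebD_primitive]). *)

(** * Generalized binomial coefficients *)

(** The binomial coefficient binom x r with a real upper argument.  Pascal's
    rule and the absorption identity then hold without side conditions, and the
    value is 0 at integers 0 <= x < r, unlike [Binomial.C]. *)
Fixpoint gbin (r : nat) (x : R) : R :=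
  match r with
  | 0%nat => 1
  | S r' => gbin r' x * (x - INR r') / INR (S r')
  end.

Lemma gbin_S r x : gbin (S r) x = gbin r x * (x - INR r) / INR (S r).
Proof. reflexivity. Qed.

Lemma INR_S_neq0 n : INR (S n) <> 0.
Proof. apply not_0_INR; lia. Qed.

Lemma gbin_absorb r x : gbin (S r) (x + 1) = gbin r x * (x + 1) / INR (S r).
Proof.
induction r as [|r IH].
- simpl; field.
- rewrite gbin_S, IH, gbin_S.
  assert (H := INR_S_neq0 r); assert (H' := INR_S_neq0 (S r)).
  rewrite !S_INR in *; field; auto.
Qed.

Lemma gbin_pascal r x : gbin (S r) (x + 1) = gbin r x + gbin (S r) x.
Proof.
rewrite gbin_absorb, gbin_S.
assert (H := INR_S_neq0 r); rewrite !S_INR in *; field; auto.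
Qed.

Lemma gbin_small r n : (n < r)%nat -> gbin r (INR n) = 0.
Proof.
induction 1; rewrite gbin_S; [|rewrite IHle]; unfold Rdiv; ring.
Qed.

Lemma gbin_diag r : gbin r (INR r) = 1.
Proof.
induction r as [|r IH]; [reflexivity|].
rewrite S_INR, gbin_absorb, IH, S_INR.
assert (H := INR_S_neq0 r); rewrite !S_INR in *; field; auto.
Qed.

Lemma binomial_gbin r i : Binomial.C (r + i) i = gbin r (INR (r + i)).
Proof.
rewrite pascal_step1 by lia.
replace (r + i - i)%nat with r by lia.
unfold Binomial.C; replace (r + i - r)%nat with i by lia.
induction r as [|r IH].
- simpl; field; apply INR_fact_neq_0.
- assert (H := INR_S_neq0 r).
  assert (H1 := INR_fact_neq_0 r); assert (H2 := INR_fact_neq_0 i).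
  rewrite plus_Sn_m, (S_INR (r + i)), gbin_absorb, <- IH, <- S_INR, !fact_simpl,
    !mult_INR.
  field; auto.
Qed.

(** The product is a falling factorial starting at x - k. *)
Lemma prod_gbin x k r :
  prod_f_R0 (fun l => x - INR (k + l)) r =
  INR (fact (S r)) * gbin (S r) (x - INR k).
Proof.
induction r as [|r IH].
- simpl; rewrite Nat.add_0_r; field.
- change (prod_f_R0 ?f (S r)) with (prod_f_R0 f r * f (S r)).
  rewrite (gbin_S (S r)), IH, (fact_simpl (S r)), mult_INR, plus_INR.
  assert (H := INR_S_neq0 (S r)); field; auto.
Qed.

Lemma gbin_hockey_stick r M :
  sum_f_R0 (fun i => gbin r (INR (r + i))) M = gbin (S r) (INR (S r + M)).
Proof.
induction M as [|M IHM].
- cbn [sum_f_R0]; rewrite !Nat.add_0_r, !gbin_diag; reflexivity.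
- rewrite tech5, IHM, (Nat.add_succ_r (S r)), (S_INR (S r + M)), gbin_pascal.
  replace (r + S M)%nat with (S r + M)%nat by lia; ring.
Qed.

(** Induction on s + M: Pascal's rule applied to the second factor splits the
    (s+1, M+1) sum into the (s, M+1) and (s+1, M) sums, and the right-hand side
    splits in the same way; s = 0 is the hockey-stick identity. *)
Lemma gbin_convolution r s M :
  sum_f_R0 (fun i => gbin r (INR (r + i)) * gbin s (INR (s + M) - INR i)) M
  = gbin (S (r + s)) (INR (S (r + s) + M)).
Proof.
revert M; induction s as [|s IHs].
- intros M; rewrite Nat.add_0_r, <- gbin_hockey_stick.
  apply sum_eq; intros i _; apply Rmult_1_r.
- intros M; induction M as [|M IHM].
  + cbn [sum_f_R0]; change (INR 0) with 0.
    rewrite !Nat.add_0_r, Rminus_0_r, !gbin_diag; ring.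
  + rewrite tech5.
    replace (S (r + S s) + S M)%nat with (S (S (r + S s) + M)) by lia.
    rewrite (S_INR (S (r + S s) + M)), gbin_pascal, <- IHM.
    replace (r + S s)%nat with (S (r + s)) by lia.
    replace (S (S (r + s)) + M)%nat with (S (r + s) + S M)%nat by lia.
    rewrite <- IHs, tech5.
    rewrite (sum_eq _ (fun i =>
      gbin r (INR (r + i)) * gbin s (INR (s + S M) - INR i) +
      gbin r (INR (r + i)) * gbin (S s) (INR (S s + M) - INR i))).
    * rewrite sum_plus.
      replace (INR (s + S M) - INR (S M)) with (INR s)
        by (rewrite plus_INR; ring).
      replace (INR (S s + S M) - INR (S M)) with (INR (S s))
        by (rewrite plus_INR; ring).
      rewrite !gbin_diag; ring.
    * intros i _.
      replace (INR (S s + S M) - INR i) with ((INR (s + S M) - INR i) + 1)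
        by (rewrite !plus_INR, !S_INR; ring).
      rewrite gbin_pascal.
      replace (INR (S s + M) - INR i) with (INR (s + S M) - INR i)
        by (rewrite !plus_INR, !S_INR; ring).
      ring.
Qed.

(** * Chebyshev polynomials and their derivatives *)

(** [chebD m p] is the p-th derivative of T_m; the recursion is Leibniz's rule
    applied p times to T_(m+2) = 2 x T_(m+1) - T_m.  For p = 0 the factor [INR p]
    cancels the meaningless term of index [pred p]. *)
Fixpoint chebD (m p : nat) (x : R) : R :=
  match m with
  | 0%nat => match p with 0%nat => 1 | _ => 0 end
  | S m' =>
    match m' with
    | 0%nat => match p with 0%nat => x | 1%nat => 1 | _ => 0 end
    | S m'' =>
      2 * x * chebD m' p x + 2 * INR p * chebD m' (pred p) x - chebD m'' p x
    end
  end.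

Lemma chebD_SS m p x :
  chebD (S (S m)) p x =
  2 * x * chebD (S m) p x + 2 * INR p * chebD (S m) (pred p) x - chebD m p x.
Proof. reflexivity. Qed.

Lemma nat_two_step_ind (P : nat -> Prop) :
  P 0%nat -> P 1%nat -> (forall m, P m -> P (S m) -> P (S (S m))) ->
  forall m, P m.
Proof.
intros H0 H1 HS m; enough (P m /\ P (S m)) by tauto.
induction m as [|m [IH IH']]; auto.
Qed.

Lemma chebT_chebD m x : -1 <= x <= 1 -> chebT m x = chebD m 0 x.
Proof.
intros Hx; unfold chebT.
induction m as [| |m IH IH'] using nat_two_step_ind.
- simpl; rewrite Rmult_0_l; apply cos_0.
- simpl; rewrite Rmult_1_l; now apply cos_acos.
- rewrite chebD_SS, <- IH, <- IH'; change (INR 0) with 0.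
  set (t := acos x).
  replace (INR (S (S m)) * t) with (INR (S m) * t + t)
    by (rewrite (S_INR (S m)); ring).
  replace (INR m * t) with (INR (S m) * t - t) by (rewrite S_INR; ring).
  rewrite cos_plus, cos_minus.
  replace x with (cos t) by now apply cos_acos.
  ring.
Qed.

Lemma chebD_derive m p x : is_derive (chebD m p) x (chebD m (S p) x).
Proof.
revert p; induction m as [| |m IH IH'] using nat_two_step_ind; intros p.
- destruct p; simpl; auto_derive; auto.
- destruct p as [|[|p]]; simpl; auto_derive; auto.
- rewrite chebD_SS.
  apply is_derive_ext with (fun t => 2 * t * chebD (S m) p t +
    2 * INR p * chebD (S m) (pred p) t - chebD m p t); [reflexivity|].
  assert (H := IH p); assert (H' := IH' p); assert (H'' := IH' (pred p)).
  set (f := chebD (S m) p) in *; set (g := chebD (S m) (pred p)) in *.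
  set (h := chebD m p) in *.
  auto_derive; [repeat split; eexists; eauto|].
  change (fun t => f t) with f; change (fun t => g t) with g.
  change (fun t => h t) with h.
  rewrite (is_derive_unique _ _ _ H), (is_derive_unique _ _ _ H'),
    (is_derive_unique _ _ _ H'').
  destruct p; cbn [pred]; rewrite ?S_INR; unfold f; simpl INR; ring.
Qed.

(** T_m has degree m. *)
Lemma chebD_above_degree m p x : (m < p)%nat -> chebD m p x = 0.
Proof.
revert p; induction m as [| |m IH IH'] using nat_two_step_ind; intros p Hp.
- destruct p; [lia|reflexivity].
- destruct p as [|[|p]]; [lia|lia|reflexivity].
- rewrite chebD_SS, IH, !IH' by lia; ring.
Qed.

(** T_m has the parity of m, and each derivative reverses parity. *)
Lemma chebD_opp m p x : chebD m p (- x) = (-1) ^ (m + p) * chebD m p x.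
Proof.
revert p; induction m as [| |m IH IH'] using nat_two_step_ind; intros p.
- destruct p; simpl; ring.
- destruct p as [|[|p]]; simpl; ring.
- rewrite !chebD_SS, IH, !IH'.
  destruct p; change (INR 0) with 0; cbn [pred Nat.add];
    rewrite ?Nat.add_succ_r; cbn [pow]; ring.
Qed.

Lemma chebD_at_opp1 m p : chebD m p (-1) = (-1) ^ (m + p) * chebD m p 1.
Proof. exact (chebD_opp m p 1). Qed.

(** The sum of two binomial coefficients, rather than a single one multiplied by
    m, makes the recurrence in m a direct consequence of Pascal's rule: the
    second difference of binom x (2p+2) in x is binom x (2p). *)
Lemma chebD_at_1 m p :
  chebD m p 1 = 2 ^ p / 2 * INR (fact p) *
    (gbin (2 * p) (INR (m + p)) + gbin (2 * p) (INR (m + p) - 1)).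
Proof.
revert p; induction m as [| |m IH IH'] using nat_two_step_ind; intros p.
- destruct p as [|p]; [simpl; field|].
  replace (INR (0 + S p) - 1) with (INR p) by (rewrite plus_INR, S_INR; simpl; ring).
  rewrite !gbin_small by lia; simpl chebD; ring.
- destruct p as [|[|p]]; [simpl; field|simpl; field|].
  replace (INR (1 + S (S p)) - 1) with (INR (S (S p)))
    by (rewrite plus_INR, !S_INR; simpl; ring).
  rewrite !gbin_small by lia; simpl chebD; ring.
- rewrite chebD_SS, IH, !IH'.
  destruct p as [|p]; [simpl; field|].
  (* Pascal's rule used twice: the second difference lowers the index by 2. *)
  assert (Hd : forall x, gbin (2 * S p) (x + 1 + 1) =
      gbin (2 * p) x + 2 * gbin (2 * S p) (x + 1) - gbin (2 * S p) x).
  { intros x; replace (2 * S p)%nat with (S (S (2 * p))) by lia.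
    rewrite !gbin_pascal; ring. }
  simpl pred.
  replace (INR (S (S m) + S p)) with (INR (m + S p) + 1 + 1)
    by (rewrite !plus_INR, !S_INR; ring).
  replace (INR (m + S p) + 1 + 1 - 1) with (INR (m + S p) - 1 + 1 + 1) by ring.
  replace (INR (S m + S p)) with (INR (m + S p) + 1)
    by (rewrite !plus_INR, !S_INR; ring).
  replace (INR (m + S p) + 1 - 1) with (INR (m + S p) - 1 + 1) by ring.
  replace (INR (S m + p)) with (INR (m + S p))
    by (rewrite !plus_INR, !S_INR; ring).
  rewrite !Hd, fact_simpl, mult_INR; simpl pow; field.
Qed.

(** With N = m + q, the binomial coefficients binom (N+1) (2q+2) and
    binom N (2q+2) are binom N (2q+1) times (N+1)/(2q+2) and
    (N-2q-1)/(2q+2); these two factors add up to m/(q+1). *)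
Lemma chebD_S_at_1 m q :
  chebD m (S q) 1 =
  2 ^ q * INR (fact q) * INR m * gbin (S (q + q)) (INR (m + q)).
Proof.
rewrite chebD_at_1.
replace (2 * S q)%nat with (S (S (q + q))) by lia.
replace (INR (m + S q)) with (INR (m + q) + 1) by (rewrite !plus_INR, S_INR; ring).
replace (INR (m + q) + 1 - 1) with (INR (m + q)) by ring.
rewrite gbin_absorb.
rewrite (gbin_S (S (q + q))), fact_simpl, mult_INR.
assert (H := INR_S_neq0 q).
replace (INR (S (S (q + q)))) with (2 * INR (S q))
  by (rewrite !S_INR, plus_INR; ring).
replace (INR (S (q + q))) with (2 * INR (S q) - 1)
  by (rewrite !S_INR, plus_INR; ring).
rewrite plus_INR; simpl pow.
replace (INR q) with (INR (S q) - 1) by (rewrite S_INR; ring).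
field; auto.
Qed.

(** After the shift k = i + 1, with p + 2 in place of p, the product over j is
    (p+1)! binom (m-1-i) (p+1), so the sum over k is a convolution with
    r = s = p + 1. *)
Lemma alpha_chebD m p :
  (p <= m)%nat -> alpha m (S p) = (-1) ^ (m + p) * chebD m p 1.
Proof.
intros Hp; destruct p as [|[|p]].
- rewrite chebD_at_1; simpl; rewrite Nat.add_0_r; field.
- rewrite chebD_S_at_1; simpl. rewrite Nat.add_0_r; field.
- rewrite chebD_S_at_1; unfold alpha.
  replace (m + S (S (S p)) - 1)%nat with (m + S (S p))%nat by lia.
  replace (S (S (S p)) - 2)%nat with (S p) by lia.
  replace (S (S (S p)) - 3)%nat with p by lia.
  replace (m + 2 - S (S (S p)))%nat with (S (m - S (S p))) by lia.
  set (M := (m - S (S p))%nat).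
  rewrite <- sum_n_m_S.
  change (sum_n_m ?f 0 M) with (sum_n f M); rewrite sum_n_Reals.
  rewrite (sum_eq _ (fun i =>
     gbin (S p) (INR (S p + i)) * gbin (S p) (INR (S p + M) - INR i)
     * INR (fact (S p)))).
  + rewrite <- scal_sum, gbin_convolution.
    replace (S (S p + S p) + M)%nat with (m + S p)%nat by lia.
    ring.
  + intros i Hi.
    replace (S (S (S p)) + S i - 3)%nat with (S p + i)%nat by lia.
    replace (S i - 1)%nat with i by lia.
    rewrite binomial_gbin, Rmult_assoc; f_equal.
    replace (S p + M)%nat with (m - 1)%nat by lia.
    rewrite Rmult_comm, prod_gbin.
    do 2 f_equal; rewrite minus_INR, S_INR by lia; simpl; ring.
Qed.

(** Chebyshev polynomials of the second kind with the index shifted by one: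
    [chebU m] is U_(m-1), that is sin (m t) / sin t at x = cos t. *)
Fixpoint chebU (m : nat) (x : R) : R :=
  match m with
  | 0%nat => 0
  | S m' =>
    match m' with
    | 0%nat => 1
    | S m'' => 2 * x * chebU m' x - chebU m'' x
    end
  end.

Lemma chebU_S m x : chebU (S m) x = x * chebU m x + chebD m 0 x.
Proof.
induction m as [| |m IH IH'] using nat_two_step_ind; [simpl; ring|simpl; ring|].
change (chebU (S (S (S m))) x) with (2 * x * chebU (S (S m)) x - chebU (S m) x).
rewrite chebD_SS; change (chebU (S (S m)) x) with (2 * x * chebU (S m) x - chebU m x).
change (chebU (S (S m)) x) with (2 * x * chebU (S m) x - chebU m x) in IH'.
simpl INR; nra.
Qed.

Lemma chebD_1_chebU m x : chebD m 1 x = INR m * chebU m x.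
Proof.
induction m as [| |m IH IH'] using nat_two_step_ind; [simpl; ring|simpl; ring|].
rewrite chebD_SS, IH, IH', !S_INR.
assert (H := chebU_S (S m) x).
change (chebU (S (S m)) x) with (2 * x * chebU (S m) x - chebU m x) in *.
simpl pred; simpl (INR 0).
replace (chebD (S m) 0 x) with (x * chebU (S m) x - chebU m x) by lra.
ring.
Qed.

Lemma chebD_0_at_1 m : chebD m 0 1 = 1.
Proof. rewrite chebD_at_1; simpl; field. Qed.

(** The derivative of the numerator is
    m (m+1) (U_m - x U_(m-1)) - (m+1) T_m, and U_m - x U_(m-1) = T_m. *)
Lemma chebD_primitive m x : m <> 1%nat ->
  is_derive (fun t => (INR m * chebD (S m) 0 t - (INR m + 1) * t * chebD m 0 t)
    / (INR m ^ 2 - 1)) x (chebD m 0 x).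
Proof.
intros Hm.
assert (Hm' : INR m ^ 2 - 1 <> 0).
{ replace (INR m ^ 2 - 1) with ((INR m - INR 1) * (INR m + INR 1)) by (simpl; ring).
  assert (H := pos_INR m); assert (H' : INR m <> INR 1) by now apply not_INR.
  apply Rmult_integral_contrapositive; simpl in *; lra. }
assert (E := chebD_derive m 0 x); assert (E' := chebD_derive (S m) 0 x).
set (f := chebD m 0) in *; set (g := chebD (S m) 0) in *.
auto_derive; [repeat split; eexists; eauto|].
change (fun t => f t) with f; change (fun t => g t) with g.
rewrite (is_derive_unique _ _ _ E), (is_derive_unique _ _ _ E').
unfold f; rewrite !chebD_1_chebU, chebU_S, S_INR; field.
now replace (INR m * INR m) with (INR m ^ 2) by ring.
Qed.

(** * Integration against a complex exponential *)

Lemma is_derive_pair (u v : R -> R) (x u' v' : R) :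
  is_derive u x u' -> is_derive v x v' ->
  is_derive (V := C_R_NormedModule) (fun t => (u t, v t) : C) x (u', v').
Proof.
intros Hu Hv.
assert (H1 := is_derive_scal_l (V := C_R_NormedModule) u x u' (1, 0) Hu).
assert (H2 := is_derive_scal_l (V := C_R_NormedModule) v x v' (0, 1) Hv).
assert (H := is_derive_plus (V := C_R_NormedModule) _ _ _ _ _ H1 H2).
assert (E : forall a b : R, plus (scal a ((1, 0) : C_R_NormedModule))
  (scal b ((0, 1) : C_R_NormedModule)) = (a, b)).
{ intros a b; apply injective_projections; simpl;
  unfold plus, scal; simpl; unfold mult; simpl; ring. }
rewrite E in H.
revert H; apply is_derive_ext; intros t; apply E.
Qed.

Lemma is_derive_Cexp_mult (mu c : C) (f : R -> R) (x f' : R) :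
  is_derive f x f' ->
  is_derive (V := C_R_NormedModule)
    (fun t => (Cexp (- (mu * RtoC t)) * RtoC (f t) * c)%C) x
    (Cexp (- (mu * RtoC x)) * (RtoC f' - mu * RtoC (f x)) * c)%C.
Proof.
intros Hf; destruct mu as [a b], c as [c d].
assert (Hc : forall g : R -> R, is_derive g x f' -> Derive g x = f')
  by (intros; now apply is_derive_unique).
match goal with |- is_derive ?F x ?l =>
  replace l with ((Re l, Im l) : C) by (now destruct l);
  apply (is_derive_pair (fun t => Re (F t)) (fun t => Im (F t))) end.
all: unfold Cexp, Cmult, Cminus, Cplus, Copp, RtoC, Re, Im; simpl.
all: auto_derive; [repeat split; exists f'; exact Hf|].
all: rewrite !Hc by exact Hf; unfold Rminus; ring.
Qed.

Lemma chebT_hat_antiderivative m (lambda : C) (G : R -> C) :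
  (forall x, is_derive (V := C_R_NormedModule) G x
     (Cexp (- (Ci * lambda * RtoC x)) * RtoC (chebD m 0 x))%C) ->
  chebT_hat m lambda = (G 1 - G (-1))%C.
Proof.
intros HG; unfold chebT_hat.
apply (is_RInt_unique (V := C_R_CompleteNormedModule)).
apply (is_RInt_ext (V := C_R_NormedModule))
  with (fun x => (Cexp (- (Ci * lambda * RtoC x)) * RtoC (chebD m 0 x))%C).
- intros x; rewrite Rmin_left, Rmax_right by lra; intros Hx.
  rewrite chebT_chebD by lra; reflexivity.
- apply (is_RInt_derive (V := C_R_CompleteNormedModule)); intros x _; [apply HG|].
  apply (ex_derive_continuous (K := R_AbsRing) (V := C_R_NormedModule)).
  eexists.
  eapply is_derive_ext; [|apply (is_derive_Cexp_mult (Ci * lambda) 1 (chebD m 0)),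
    chebD_derive].
  intros t; simpl; apply Cmult_1_r.
Qed.

(** Each summand of the N-term sum contributes
    exp (- mu x) (f_(n-1) / mu^(n-1) - f_n / mu^n), so the derivatives telescope
    and leave the usual remainder. *)
Lemma is_derive_by_parts (f : nat -> R -> R) (mu : C) (N : nat) (x : R) :
  mu <> RtoC 0 ->
  (forall p, is_derive (f p) x (f (S p) x)) ->
  is_derive (V := C_R_NormedModule)
    (fun t => sum_n_m (G := C_AbelianGroup) (fun n =>
       (Cexp (- (mu * RtoC t)) * RtoC (f (pred n) t) * - / mu ^ n)%C) 1 N) x
    (Cexp (- (mu * RtoC x)) * (RtoC (f 0%nat x) - RtoC (f N x) / mu ^ N))%C.
Proof.
intros Hmu Hf; induction N as [|N IH].
- replace (Cexp (- (mu * RtoC x)) * (RtoC (f 0%nat x) - RtoC (f 0%nat x) / mu ^ 0))%C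
    with (@zero C_R_NormedModule).
  + apply is_derive_ext with (fun _ => @zero C_R_NormedModule).
    * intros t; rewrite sum_n_m_zero by lia; reflexivity.
    * apply (is_derive_const (V := C_R_NormedModule)).
  + change (@zero C_R_NormedModule) with (RtoC 0); simpl; field.
- assert (HN := Cpow_nz _ N Hmu).
  assert (H := is_derive_plus (V := C_R_NormedModule) _ _ _ _ _ IH
    (is_derive_Cexp_mult mu (- / mu ^ S N) _ _ _ (Hf N))).
  match type of H with is_derive _ _ ?l => match goal with |- is_derive _ _ ?l' =>
    replace l' with l end end.
  + revert H; apply is_derive_ext; intros t.
    rewrite sum_n_Sm by lia; reflexivity.
  + change (@plus C_R_NormedModule) with Cplus; simpl; field; auto.
Qed.

Lemma Cexp_0 : Cexp 0 = 1.
Proof.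
unfold Cexp; simpl; rewrite exp_0, cos_0, sin_0.
apply injective_projections; simpl; ring.
Qed.

(** At lambda = 0 the exponential is 1 and the integral is that of a real
    function. *)
Lemma chebT_hat_0 m (g : R -> R) :
  (forall x, is_derive g x (chebD m 0 x)) ->
  chebT_hat m 0 = RtoC (g 1 - g (-1)).
Proof.
intros Hg.
rewrite (chebT_hat_antiderivative m 0
  (fun t => (Cexp (- (Ci * 0 * RtoC t)) * RtoC (g t) * 1)%C)).
- assert (E : forall t, (- (Ci * 0 * RtoC t) = 0)%C) by (intros; ring).
  rewrite !E, Cexp_0, RtoC_minus; ring.
- intros x.
  assert (H := is_derive_Cexp_mult (Ci * 0) 1 g x _ (Hg x)).
  replace (Cexp (- (Ci * 0 * RtoC x)) * RtoC (chebD m 0 x))%C with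
   (Cexp (- (Ci * 0 * RtoC x)) * (RtoC (chebD m 0 x) - Ci * 0 * RtoC (g x)) * 1)%C
   by ring.
  exact H.
Qed.

(** * The finite Fourier transform *)

Theorem theorem1 :
  chebT_hat 1 (RtoC 0) = RtoC 0 /\
  (forall m : nat, m <> 1%nat ->
    chebT_hat m (RtoC 0) =
    RtoC (((-1) ^ (m + 1) - 1) / (INR m ^ 2 - 1))) /\
  (forall (m : nat) (lambda : C), lambda <> RtoC 0 ->
    chebT_hat m lambda =
    sum_n_m
      (fun n : nat =>
         (RtoC (alpha m n) *
          (Cexp (Ci * lambda) / (Ci * lambda) ^ n +
           RtoC ((-1) ^ (n + m))%R *
           (Cexp (- (Ci * lambda)) / (Ci * lambda) ^ n)))%C)
      1 (m + 1)).
Proof.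
split; [|split].
- rewrite (chebT_hat_0 1 (fun t => t ^ 2 / 2)).
  + f_equal; field.
  + intros x; auto_derive; [trivial|simpl; field].
- intros m Hm; rewrite (chebT_hat_0 m _ (fun x => chebD_primitive m x Hm)).
  f_equal; rewrite !chebD_at_opp1, !chebD_0_at_1.
  rewrite !Nat.add_0_r, Nat.add_1_r; simpl pow; unfold Rdiv; ring.
- intros m lambda Hl.
  set (mu := (Ci * lambda)%C).
  assert (Hmu : mu <> RtoC 0).
  { apply Cmult_neq_0; [|exact Hl]; intros H; injection H; lra. }
  rewrite (chebT_hat_antiderivative m lambda
    (fun t => sum_n_m (G := C_AbelianGroup) (fun n =>
       (Cexp (- (mu * RtoC t)) * RtoC (chebD m (pred n) t) * - / mu ^ n)%C)
       1 (S m))).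
  2: {
    intros x.
    assert (H := is_derive_by_parts _ mu (S m) x Hmu
      (fun p => chebD_derive m p x)).
    rewrite (chebD_above_degree m (S m)) in H by lia.
    unfold Cdiv in H; rewrite Cmult_0_l in H; unfold Cminus in H.
    rewrite Copp_0, Cplus_0_r in H; exact H. }
  rewrite Nat.add_1_r.
  match goal with |- Cminus ?a ?b = ?c => enough (H : a = Cplus c b)
    by (rewrite H; ring) end.
  change Cplus with (@plus C_AbelianGroup); rewrite <- sum_n_m_plus.
  apply sum_n_m_ext_loc; intros [|p] [Hp Hp']; [lia|].
  change (@plus C_AbelianGroup) with Cplus.
  simpl pred.
  rewrite alpha_chebD, chebD_at_opp1, !RtoC_mult by lia.
  replace (-(mu * RtoC 1))%C with (- mu)%C by ring.
  replace (-(mu * RtoC (-1)))%C with mu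
    by (change (-1) with (- (1)); rewrite RtoC_opp; ring).
  (* The sign of T_m^(p)(-1) is already contained in alpha, so the two signs in
     front of exp (- mu) combine to the -1 of the antiderivative. *)
  assert (Hs : (RtoC ((-1) ^ (m + p)) * RtoC ((-1) ^ (S p + m)) = - RtoC 1)%C).
  { rewrite <- RtoC_mult, <- RtoC_opp; f_equal.
    replace (S p + m)%nat with (S (m + p)) by lia; simpl.
    assert (H := pow_1_even (m + p)).
    replace (2 * (m + p))%nat with ((m + p) + (m + p))%nat in H by lia.
    rewrite pow_add in H; lra. }
  set (s := RtoC ((-1) ^ (m + p))) in *.
  set (s' := RtoC ((-1) ^ (S p + m))) in *.
  replace (s * RtoC (chebD m p 1) * (Cexp mu / mu ^ S p + s' * (Cexp (- mu) / mu ^ S p)))%C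
   with (s * RtoC (chebD m p 1) * (Cexp mu / mu ^ S p)
      + RtoC (chebD m p 1) * (s * s') * (Cexp (- mu) / mu ^ S p))%C by ring.
  rewrite Hs; unfold Cdiv.
  match goal with |- ?a = ?b => change (@eq C a b) end; ring.
Qed.
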